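(* Let $p>0$ be a prime integer, and consider: \begin{enumerate} \item[(a)] $R=\mathbb{Z}[X]/(\det X)$, where $X$ is an $n\times n$ matrix of indeterminates over $\mathbb{Z}$, $n\geqslant 3$; \item[(b)] $R=\mathbb{Z}[X]/(\operatorname{pf}X)$, where $X$ is an $n\times n$ alternating matrix of indeterminates over $\mathbb{Z}$ and $n\geqslant 4$ is even ($\operatorname{pf}$ = Pfaffian); \item[(c)] $R=\mathbb{Z}[X]/(\det X)$, where $X$ is an $n\times n$ symmetric matrix of indeterminates over $\mathbb{Z}$, $n\geqslant 3$. \end{enumerate} In cases (a) and (b), the Frobenius endomorphism of $R/pR$ does not lift to a ring endomorphism of $R/p^2R$, nor, a fortiori, to a ring endomorphism of $R$. In case (c), the same conclusion holds if $p=2$, or if $p>2$ and $n\geqslant 4$.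
   Context: A lift of the Frobenius endomorphism $F$ of $R/pR$ to $R/p^2R$ is a ring endomorphism $\Lambda$ of $R/p^2R$ such that reducing modulo $p$ gives $F$, i.e. $\Lambda(r)\equiv r^p \pmod{p}$ for all $r$. *)

(* Defs.v *)
From HB Require Import structures.
From mathcomp Require Import all_boot all_order all_algebra all_fingroup.
From mathcomp Require Import mpoly.
Set Implicit Arguments. Unset Strict Implicit. Unset Printing Implicit Defensive.
Import GRing.Theory.
Local Open Scope ring_scope.

Definition ZX (T : finType) := {mpoly int[#|{: T}|]}.
Definition var (T : finType) (x : T) : ZX T := 'X_(enum_rank x).

Definition genX n : 'M[ZX ('I_n * 'I_n)%type]_n :=
  \matrix_(i, j) var (i, j).

Definition symI n := {x : 'I_n * 'I_n | (x.1 <= x.2)%N}.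
Definition symX n : 'M[ZX (symI n)]_n :=
  \matrix_(i, j) if (i <= j)%N
                 then oapp (@var _) 0 (insub (i, j) : option (symI n))
                 else oapp (@var _) 0 (insub (j, i) : option (symI n)).

(* (b) alternating matrix: indeterminates X_ij for i < j, X_ji = - X_ij, X_ii = 0 *)
Definition altI n := {x : 'I_n * 'I_n | (x.1 < x.2)%N}.
Definition altX n : 'M[ZX (altI n)]_n :=
  \matrix_(i, j) (oapp (@var _) 0 (insub (i, j) : option (altI n))
                  - oapp (@var _) 0 (insub (j, i) : option (altI n))).

(* Pfaffian of a 2m x 2m matrix, as a signed sum over perfect matchings:
   pf A = sum over s with s(2i) < s(2i+1) and s(0) < s(2) < ... < s(2m-2)
          of sgn(s) * prod_i A_{s(2i), s(2i+1)}. *)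
Lemma ev_lt m (i : 'I_m) : (i.*2 < m.*2)%N.
Proof. by rewrite ltn_double. Qed.
Lemma od_lt m (i : 'I_m) : (i.*2.+1 < m.*2)%N.
Proof. by rewrite -doubleS leq_double. Qed.
Definition ev m (i : 'I_m) : 'I_(m.*2) := Ordinal (ev_lt i).
Definition od m (i : 'I_m) : 'I_(m.*2) := Ordinal (od_lt i).
Definition pf_perm m (s : 'S_(m.*2)) : bool :=
  [forall i : 'I_m, (s (ev i) < s (od i))%N] &&
  [forall i : 'I_m, forall j : 'I_m, (i < j)%N ==> (s (ev i) < s (ev j))%N].
Definition pfaffian (R : comPzRingType) m (A : 'M[R]_(m.*2)) : R :=
  \sum_(s : 'S_(m.*2) | pf_perm s) (-1) ^+ s * \prod_(i < m) A (s (ev i)) (s (od i)).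

Definition in_ideal2 k (f g q : {mpoly int[k]}) : Prop :=
  exists a b : {mpoly int[k]}, q = a * f + b * g.
Definition in_ideal1 k (f q : {mpoly int[k]}) : Prop :=
  exists a : {mpoly int[k]}, q = a * f.

Definition presents k (I : {mpoly int[k]} -> Prop) (S : comPzRingType)
  (pi : {rmorphism {mpoly int[k]} -> S}) : Prop :=
  (forall s : S, exists q, pi q = s) /\ (forall q, pi q = 0 <-> I q).

Definition frobenius_lift (p : nat) (S : comPzRingType) (L : {rmorphism S -> S}) : Prop :=
  forall r : S, exists s : S, L r - r ^+ p = p%:R * s.

Definition no_frobenius_lift k (f : {mpoly int[k]}) (p : nat) : Prop :=
  (forall (S : comPzRingType) (pi : {rmorphism {mpoly int[k]} -> S}),
      presents (in_ideal2 f ((p ^ 2)%N%:R)) pi ->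
      ~ exists L : {rmorphism S -> S}, frobenius_lift p L)
  /\
  (forall (S : comPzRingType) (pi : {rmorphism {mpoly int[k]} -> S}),
      presents (in_ideal1 f) pi ->
      ~ exists L : {rmorphism S -> S}, frobenius_lift p L).

(* Main.v *)
(** A Frobenius lift sends each variable x_v to x_v^p + p g_v, and then
    f(x_v^p + p g_v) lies in (f, p^2).  Each f is homogeneous for a torus of
    row and column weights; extracting the component of p times the weight of f
    replaces g_v by its component of weight p w_v, which in the cases needed is
    a constant multiple of x_v^p.  Hence f((1 + p c_v) x_v^p) vanishes modulo
    p^2 at every point where f does.  At a suitable singular matrix over
    (Z/p^2)[s], with entries 0, 1, s, s + 1, this would make (s + 1)^p a
    combination of s^p and 1 (or give the analogous quadratic relation for
    symmetric matrices), which the linear term p s of (s + 1)^p forbids.  For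
    symmetric matrices and p = 2 an integral singular matrix suffices. *)

Require Import Defs.
From HB Require Import structures.
From mathcomp Require Import all_boot all_order all_algebra all_fingroup.
From mathcomp Require Import mpoly.
From mathcomp Require Import ring zify.
Set Implicit Arguments.
Unset Strict Implicit.
Unset Printing Implicit Defensive.
Import GRing.Theory.
Local Open Scope ring_scope.

(** * Leading terms of determinants and Pfaffians over a ring with e^2 = 0 *)

Lemma ev_od_bij m :
  bijective (fun x : 'I_m * bool => if x.2 then od x.1 else ev x.1).
Proof.
apply: inj_card_bij; last by rewrite card_prod card_bool !card_ord muln2.
move=> [i a] [j b] /(congr1 val) E; have ij : val i = val j.
  by case: a b E => -[] /=; lia.
by case: a b E => -[] /=; rewrite (ord_inj ij) // => ?; lia.
Qed.

Lemma big_ev_od (R : Type) (idx : R) (op : Monoid.com_law idx) m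
    (F : 'I_m.*2 -> R) :
  \big[op/idx]_i F i = \big[op/idx]_(i < m) op (F (ev i)) (F (od i)).
Proof.
rewrite (reindex _ (onW_bij _ (ev_od_bij m))) /=.
rewrite -(pair_bigA _ (fun i (b : bool) => F (if b then od i else ev i))) /=.
by apply: eq_bigr => i _; rewrite big_bool /= Monoid.mulmC.
Qed.

(* Since e^2 = 0, this is compatible with products: the terms in e * h only
   ever meet the leading monomial of the other factor. *)
Definition leading (B : comNzRingType) (r : nat) (e : B) (u : 'X_{1..r})
    (q : {mpoly B[r]}) (a : B) : Prop :=
  exists2 h, q = a%:MP * 'X_[u] + e%:MP * h & h@_u = 0.

Section Leading.
Variables (B : comNzRingType) (r : nat) (e : B).
Hypothesis e2 : e * e = 0.
Implicit Types (u v : 'X_{1..r}) (q : {mpoly B[r]}) (a b : B).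

Lemma leadingC u q a : q = a%:MP * 'X_[u] -> leading e u q a.
Proof. by move=> ->; exists 0; rewrite ?mulr0 ?addr0 ?mcoeff0. Qed.

(** The coefficient of X^u in q moves into the leading constant, so a correction e q affects the
    constant only through q_u. *)
Lemma leading_coeff u a q :
  leading e u (a%:MP * 'X_[u] + e%:MP * q) (a + e * q@_u).
Proof.
exists (q - (q@_u)%:MP * 'X_[u]).
  by rewrite mpolyCD mpolyCM; ring.
by rewrite mcoeffB mcoeffCM mcoeffX eqxx mulr1 subrr.
Qed.

Lemma leadingD u q1 q2 a b : leading e u q1 a -> leading e u q2 b ->
  leading e u (q1 + q2) (a + b).
Proof.
move=> [h1 -> h1u] [h2 -> h2u]; exists (h1 + h2).
  by rewrite mpolyCD; ring.
by rewrite mcoeffD h1u h2u addr0.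
Qed.

Lemma leadingN u q a : leading e u q a -> leading e u (- q) (- a).
Proof.
move=> [h -> hu]; exists (- h); first by rewrite mpolyCN; ring.
by rewrite mcoeffN hu oppr0.
Qed.

Lemma leadingM u v q1 q2 a b : leading e u q1 a -> leading e v q2 b ->
  leading e (u + v)%MM (q1 * q2) (a * b).
Proof.
move=> [h1 -> h1u] [h2 -> h2v].
exists (a%:MP * (h2 * 'X_[u]) + b%:MP * (h1 * 'X_[v])).
  have e2' : e%:MP * e%:MP = 0 :> {mpoly B[r]} by rewrite -mpolyCM e2 mpolyC0.
  (* The product e^2 h1 h2 of the two error terms is inserted as zero. *)
  rewrite mpolyCM mpolyXD -[RHS]addr0 -(mul0r (h1 * h2)) -e2'.
  by ring.
by rewrite mcoeffD !mcoeffCM mcoeffMX (addmC u v) mcoeffMX h1u h2v !mulr0 addr0.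
Qed.

Lemma leading_sign (b : bool) u q a :
  leading e u q a -> leading e u ((-1) ^+ b * q) ((-1) ^+ b * a).
Proof.
by case: b => l; rewrite !(expr0, expr1) ?mulN1r ?mul1r //; apply: leadingN.
Qed.

Lemma leading_sum (I : finType) (P : pred I) u (q : I -> {mpoly B[r]})
    (a : I -> B) :
  (forall i, P i -> leading e u (q i) (a i)) ->
  leading e u (\sum_(i | P i) q i) (\sum_(i | P i) a i).
Proof.
move=> l; apply: (big_rec2 (fun q a => leading e u q a)).
  by apply: leadingC; rewrite mpolyC0 mul0r.
by move=> i b q' Pi; apply: leadingD; apply: l.
Qed.

Lemma leading_prod (I : finType) (u : I -> 'X_{1..r}) (q : I -> {mpoly B[r]})
    (a : I -> B) :
  (forall i, leading e (u i) (q i) (a i)) ->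
  leading e (\sum_i u i)%MM (\prod_i q i) (\prod_i a i).
Proof.
move=> l; apply: (big_rec3 (fun u q a => leading e u q a)).
  by apply: leadingC; rewrite mpolyX0 mulr1.
by move=> i v b q' _; apply: leadingM; apply: l.
Qed.

(** A permutation meets each row and each column once, so all terms of the expansion share the
    exponent sum_i s_i + sum_j t_j. *)
Lemma leading_det n (s t : 'I_n -> 'X_{1..r}) (A : 'M[{mpoly B[r]}]_n)
    (M : 'M[B]_n) :
  (forall i j, leading e (s i + t j)%MM (A i j) (M i j)) ->
  leading e (\sum_i s i + \sum_i t i)%MM (\det A) (\det M).
Proof.
move=> l; apply: leading_sum => /= g _; apply: leading_sign.
rewrite [X in (_ + X)%MM](reindex_inj (@perm_inj _ g)) /= -big_split /=.
exact: leading_prod.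
Qed.

(** A perfect matching covers each index once, so all terms share one monomial. Only entries above
    the diagonal enter, because [pf_perm] orders the two ends of each edge. *)
Lemma leading_pfaffian m (s : 'I_m.*2 -> 'X_{1..r})
    (A : 'M[{mpoly B[r]}]_(m.*2)) (M : 'M[B]_(m.*2)) :
  (forall i j : 'I_m.*2, (i < j)%N -> leading e (s i + s j)%MM (A i j) (M i j)) ->
  leading e (\sum_i s i)%MM (pfaffian A) (pfaffian M).
Proof.
move=> l; apply: leading_sum => /= g /andP[/forallP lt_g _].
apply: leading_sign.
suff -> : (\sum_i s i = \sum_(i < m) (s (g (ev i)) + s (g (od i))))%MM.
  by apply: leading_prod => i; apply: l.
rewrite (reindex_inj (@perm_inj _ g)) /=.
exact: big_ev_od.
Qed.

Lemma leading_eq0 u a : leading e u 0 a -> a = 0.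
Proof.
move=> [h /(congr1 (mcoeff u))].
by rewrite mcoeff0 mcoeffD !mcoeffCM mcoeffX eqxx mulr1 => + hu;
  rewrite hu mulr0 addr0.
Qed.

End Leading.

(** With e = 0 there is no error term, so the lemmas above also show that f vanishes on the torus
    orbit of a singular matrix. *)
Lemma leading0 (B : comNzRingType) r (u : 'X_{1..r}) (q : {mpoly B[r]}) :
  leading 0 u q 0 -> q = 0.
Proof. by move=> [h -> _]; rewrite mpolyC0 !mul0r addr0. Qed.

(** * From a Frobenius lift to an equation at a weighted point *)

Lemma mpoly_int_morph_ext k (S : pzRingType) (F G : {rmorphism {mpoly int[k]} -> S}) :
  (forall i, F 'X_i = G 'X_i) -> F =1 G.
Proof.
move=> FG q; rewrite (mpolyE q) !rmorph_sum; apply: eq_bigr => m _ /=.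
rewrite -mul_mpolyC -[q@_m]intz (rmorph_int (@mpolyC k int)) !rmorphM !rmorph_int.
congr (_ * _); rewrite mpolyXE_id !rmorph_prod; apply: eq_bigr => i _.
by rewrite !rmorphXn FG.
Qed.

Definition subst (T : finType) (S : comNzRingType) (h : T -> S) : ZX T -> S :=
  mmap intr (fun v => h (enum_val v)).
HB.instance Definition _ (T : finType) (S : comNzRingType) (h : T -> S) :=
  GRing.RMorphism.copy (subst h)
    (mmap (intr : int -> S) (fun v => h (enum_val v))).

Lemma subst_var (T : finType) (S : comNzRingType) (h : T -> S) x :
  subst h (var x) = h x.
Proof. by rewrite /subst /var mmapX mmap1U enum_rankK. Qed.

Lemma ZX_morph_ext (T : finType) (S : pzRingType) (F G : {rmorphism ZX T -> S}) :
  (forall x, F (var x) = G (var x)) -> F =1 G.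
Proof.
move=> FG; apply: mpoly_int_morph_ext => i.
by have := FG (enum_val i); rewrite /var enum_valK.
Qed.

(** Let g_x be a preimage of the error term of L at x. Then [pi] after the substitution and [L]
    after [pi] agree on variables, and the second map kills f. The larger ideal (f, p^2) serves both
    presentations. *)
Lemma lift_subst (T : finType) (f : ZX T) (p : nat) (S : comPzRingType)
    (pi : {rmorphism ZX T -> S}) (L : {rmorphism S -> S}) :
  presents (in_ideal2 f (p ^ 2)%N%:R) pi \/ presents (in_ideal1 f) pi ->
  frobenius_lift p L ->
  exists g : T -> ZX T,
    in_ideal2 f (p ^ 2)%N%:R (subst (fun x => var x ^+ p + p%:R * g x) f).
Proof.
move=> pi_pres Lp.
have pi_surj s : exists q, pi q = s by case: pi_pres => -[].
have pi_f : pi f = 0.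
  case: pi_pres => -[_ piP]; apply/piP.
    by exists 1, 0; rewrite mul1r mul0r addr0.
  by exists 1; rewrite mul1r.
have pi_ker q : pi q = 0 -> in_ideal2 f (p ^ 2)%N%:R q.
  case: pi_pres => -[_ piP] /piP // [a ->].
  by exists a, 0; rewrite mul0r addr0.
have /fin_all_exists [g gP] x :
    exists gx : ZX T, L (pi (var x)) = pi (var x ^+ p + p%:R * gx).
  have [s sP] := Lp (pi (var x)); have [q qs] := pi_surj s.
  exists q; rewrite rmorphD rmorphM rmorphXn rmorph_nat qs -sP.
  by rewrite addrC subrK.
exists g; apply: pi_ker.
pose F : {rmorphism ZX T -> S} := pi \o subst (fun x => var x ^+ p + p%:R * g x).
pose G : {rmorphism ZX T -> S} := L \o pi.
have /(_ f) : F =1 G by apply: ZX_morph_ext => x /=; rewrite subst_var gP.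
by rewrite /= pi_f rmorph0.
Qed.

(* Under x_y |-> m_y Y^(w_y), the only monomial whose image is nonzero of
   weight p w_x is then x_x^p. *)
Definition isolated (T : finType) (B : nzRingType) (r : nat)
    (m : T -> B) (w : T -> 'X_{1..r}) (x : T) : Prop :=
  w x != 0%MM /\
  forall y, m y != 0 -> (forall i, w y i != 0%N -> w x i != 0%N) -> y = x.

Lemma isolated_coeff (T : finType) (B : comNzRingType) (r p : nat)
    (m : T -> B) (w : T -> 'X_{1..r}) (x : T) (q : ZX T) :
  isolated m w x ->
  exists z : int,
    (subst (fun y => (m y)%:MP * 'X_[w y]) q)@_(w x *+ p) = z%:~R * m x ^+ p.
Proof.
move=> [wx0 iso_x].
pose P (b : B) := exists z : int, b = z%:~R * m x ^+ p.
rewrite /subst /mmap raddf_sum /=; apply: (big_ind P).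
- by exists 0; rewrite mul0r.
- by move=> _ _ [z ->] [t ->]; exists (z + t); rewrite intrD mulrDl.
move=> k _; rewrite -(rmorph_int (@mpolyC r B)) mcoeffCM.
suff : P (mmap1 (fun v => (m (enum_val v))%:MP * 'X_[w (enum_val v)]) k)@_(w x *+ p).
  by case=> z ->; exists (q@_k * z); rewrite intrM mulrA.
rewrite /mmap1.
under eq_bigr => i _ do rewrite exprMn mpolyXn -rmorphXn /=.
rewrite big_split /= -rmorph_prod /=.
rewrite -(big_morph _ (@mpolyXD r B) (@mpolyX0 r B)) mcoeffCM mcoeffX.
case: eqP => [wk | _]; last by exists 0; rewrite mulr0 mul0r.
rewrite mulr1.
(* A monomial of weight p w_x that contains a variable with m = 0 contributes nothing. *)
have [/existsP[i /andP[ki mi]] | ] :=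
    boolP [exists i, (k i != 0%N) && (m (enum_val i) == 0)].
  exists 0; rewrite (bigD1 i) //= (eqP mi) expr0n (negbTE ki) !mul0r //.
rewrite negb_exists => /forallP kP.
(* The weight of each variable present is supported inside that of p w_x, so isolation forces the
   variable to be x. *)
have supp i : k i != 0%N -> i = enum_rank x.
  move=> ki; have := kP i; rewrite ki /= => mi.
  rewrite -(iso_x (enum_val i) mi) ?enum_valK // => j wj.
  have := congr1 (fun u : 'X_{1..r} => u j) wk.
  rewrite mnm_sumE (bigD1 i) //= !mulmnE; nia.
exists 1; rewrite mul1r (bigD1 (enum_rank x)) //= enum_rankK big1 ?mulr1; last first.
  move=> i; apply: contraNeq => ne; apply/eqP/supp.
  by apply: contraNneq ne => ->; rewrite expr0.
congr (_ ^+ _).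
(* A nonzero coordinate of w_x shows that the exponent of x is p. *)
have [j wj] : exists j, w x j != 0%N.
  apply/existsP; apply: contraNT wx0; rewrite negb_exists => /forallP w0.
  by apply/eqP/mnmP => j; rewrite mnm0E; apply/eqP; rewrite -[_ == _]negbK.
have := congr1 (fun u : 'X_{1..r} => u j) wk.
rewrite mnm_sumE (bigD1 (enum_rank x)) //= big1 => [|i ne].
  by rewrite !mulmnE enum_rankK; nia.
rewrite mulmnE; have [->|/supp ei] := eqVneq (k i) 0%N; first by rewrite muln0.
by rewrite ei eqxx in ne.
Qed.

(** [F] is the lifted substitution followed by x |-> m_x Y^(w_x), and c_x is the coefficient of Y^(p
    w_x) in the image of g_x. [F] kills f because f and p^2 both vanish in the target. *)
Lemma lift_specialization (T : finType) (f : ZX T) (p : nat) (S : comPzRingType)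
    (pi : {rmorphism ZX T -> S}) (L : {rmorphism S -> S})
    (B : comNzRingType) (r : nat) (m : T -> B) (w : T -> 'X_{1..r}) :
  presents (in_ideal2 f (p ^ 2)%N%:R) pi \/ presents (in_ideal1 f) pi ->
  frobenius_lift p L ->
  (p ^ 2)%N%:R = 0 :> B ->
  subst (fun x => (m x)%:MP * 'X_[w x]) f = 0 ->
  exists (F : {rmorphism ZX T -> {mpoly B[r]}}) (c : T -> B),
    [/\ F f = 0,
        forall x, leading p%:R (w x *+ p) (F (var x)) (m x ^+ p + p%:R * c x) &
        forall x, isolated m w x -> exists z : int, c x = z%:~R * m x ^+ p].
Proof.
move=> pi_pres Lp p2 f0.
have [g [a [b fab]]] := lift_subst pi_pres Lp.
pose th : {rmorphism ZX T -> {mpoly B[r]}} :=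
  subst (fun x => (m x)%:MP * 'X_[w x]).
have {}f0 : th f = 0 := f0.
exists (th \o subst (fun x => var x ^+ p + p%:R * g x)).
exists (fun x => (th (g x))@_(w x *+ p)); split=> [|x|x iso_x].
- have pX : (p ^ 2)%N%:R = 0 :> {mpoly B[r]}.
    by rewrite -(mpolyC_nat r B (p ^ 2)%N) p2 mpolyC0.
  rewrite -[LHS]/(th (subst _ f)) fab rmorphD rmorphM f0 mulr0 add0r.
  by rewrite rmorphM rmorph_nat pX mulr0.
- rewrite -[X in leading _ _ X]/(th (subst _ (var x))) subst_var rmorphD rmorphXn.
  rewrite rmorphM rmorph_nat [th (var x)]subst_var exprMn mpolyXn -rmorphXn /=.
  by rewrite -mpolyC_nat; apply: leading_coeff.
- exact: isolated_coeff.
Qed.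

(** * Perfect matchings and Pfaffians with prescribed initial edges *)

(* The values g 2i < g 2i+1 list the edges of a perfect matching, sorted by
   smaller endpoint; the smallest unmatched vertex always comes next. *)
Lemma matching_tail (k : nat) (g : nat -> nat) :
  (forall x y, x < k.+2.*2 -> y < k.+2.*2 -> g x = g y -> x = y)%N ->
  (forall y, y < k.+2.*2 -> exists2 x, x < k.+2.*2 & g x = y)%N ->
  (forall x, x < k.+2.*2 -> g x < k.+2.*2)%N ->
  (forall i, i < k.+2 -> g i.*2 < g i.*2.+1)%N ->
  (forall i j, i < j -> j < k.+2 -> g i.*2 < g j.*2)%N ->
  (forall i, i < k.+2 -> g i.*2 < k.*2 -> g i.*2.+1 = (g i.*2).+1)%N ->
  (forall x, x <= k.*2 -> g x = x)%N /\
  [\/ [/\ g k.*2.+1 = k.*2.+1, g k.*2.+2 = k.*2.+2 & g k.*2.+3 = k.*2.+3],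
      [/\ g k.*2.+1 = k.*2.+2, g k.*2.+2 = k.*2.+1 & g k.*2.+3 = k.*2.+3] |
      [/\ g k.*2.+1 = k.*2.+3, g k.*2.+2 = k.*2.+1 & g k.*2.+3 = k.*2.+2]].
Proof.
move=> g_inj g_surj g_lt g_pair g_even g_edge.
(* The value 2i is taken at some y >= 2i. If y were not 2i, then position 2i or the partner of y
   would have a value below 2i, and such values are already taken by fixed points. *)
have next i : (i < k.+2)%N -> (forall x, x < i.*2 -> g x = x)%N -> g i.*2 = i.*2.
  move=> lt_i fix_i; have [|y lt_y gy] := g_surj i.*2; first lia.
  have le_y : (i.*2 <= y)%N.
    by case: (ltnP y i.*2) => // lt; have := fix_i _ lt; lia.
  have [j [ij lt_j yj]] : exists j, [/\ (i <= j)%N, (j < k.+2)%N &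
      y = j.*2 \/ y = j.*2.+1] by exists y./2; split; lia.
  case: yj => yj; rewrite yj in gy.
    have [E | ne] : i = j \/ i <> j by lia.
      by rewrite {1}E.
    have lt_g := g_even i j ltac:(lia) lt_j.
    have := g_inj (g i.*2) i.*2 ltac:(lia) ltac:(lia) (fix_i (g i.*2) ltac:(lia)).
    by lia.
  have lt_g := g_pair j lt_j.
  have := g_inj (g j.*2) j.*2 ltac:(lia) ltac:(lia) (fix_i (g j.*2) ltac:(lia)).
  by lia.
(* An edge starting at 2i < 2k ends at 2i + 1, so the range of fixed points grows by two at a
   time. *)
have fix_below i : (i <= k)%N -> (forall x, x < i.*2 -> g x = x)%N.
  elim: i => [|i IH] le_i x; first by lia.
  have fix_i := IH (ltnW le_i); have gi := next i ltac:(lia) fix_i.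
  have gi' := g_edge i ltac:(lia) ltac:(lia).
  have [/fix_i // | le_x] := ltnP x i.*2; move=> lt_x.
  have [-> // | ne] := eqVneq x i.*2.
  by have -> : x = i.*2.+1; lia.
have fix_k := fix_below k (leqnn k); have gk := next k ltac:(lia) fix_k.
(* Hence the last three positions permute the last three values, and the order of the final pair
   leaves three cases. *)
have above x : (k.*2 < x)%N -> (x < k.+2.*2)%N -> (k.*2 < g x)%N.
  move=> lt_kx lt_x; have [//|] := ltnP k.*2 (g x); rewrite leq_eqVlt.
  case/predU1P => [E | lt].
    by have := g_inj x k.*2 lt_x ltac:(lia) ltac:(lia); lia.
  by have := g_inj (g x) x (g_lt _ lt_x) lt_x (fix_k _ lt); lia.
split=> [x|]; first by rewrite leq_eqVlt => /predU1P[-> //|/fix_k].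
have /(_ ltac:(lia) ltac:(lia)) b1 := above k.*2.+1.
have /(_ ltac:(lia) ltac:(lia)) c1 := above k.*2.+2.
have /(_ ltac:(lia) ltac:(lia)) d1 := above k.*2.+3.
have /(_ ltac:(lia)) b2 := g_lt k.*2.+1.
have /(_ ltac:(lia)) c2 := g_lt k.*2.+2.
have /(_ ltac:(lia)) d2 := g_lt k.*2.+3.
have cd : (g k.*2.+2 < g k.*2.+3)%N by apply: (g_pair k.+1); lia.
have bc : g k.*2.+1 <> g k.*2.+2.
  by move=> /(g_inj k.*2.+1 k.*2.+2 ltac:(lia) ltac:(lia)); lia.
have bd : g k.*2.+1 <> g k.*2.+3.
  by move=> /(g_inj k.*2.+1 k.*2.+3 ltac:(lia) ltac:(lia)); lia.
have [eb|[eb|eb]] : g k.*2.+1 = k.*2.+1 \/ g k.*2.+1 = k.*2.+2 \/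
    g k.*2.+1 = k.*2.+3 by lia.
- by constructor 1; split; lia.
- by constructor 2; split; lia.
- by constructor 3; split; lia.
Qed.

(** The vanishing hypothesis leaves only matchings whose edges from vertices below 2k join
    neighbours. These differ only on the last four vertices, where the three matchings give the
    usual 4 by 4 Pfaffian. *)
Lemma pfaffian_tail (R : comPzRingType) (k : nat) (F : nat -> nat -> R) :
  (forall i j, (i < k.*2)%N -> (i < j)%N -> j != i.+1 -> F i j = 0) ->
  pfaffian (\matrix_(i < k.+2.*2, j < k.+2.*2) F i j) =
  (\prod_(i < k) F i.*2 i.*2.+1) *
  (F k.*2 k.*2.+1 * F k.*2.+2 k.*2.+3 - F k.*2 k.*2.+2 * F k.*2.+1 k.*2.+3
   + F k.*2 k.*2.+3 * F k.*2.+1 k.*2.+2).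
Proof.
move=> F0; pose n := k.+2.*2.
have lb : (k.*2.+1 < n)%N by rewrite /n; lia.
have lc : (k.*2.+2 < n)%N by rewrite /n; lia.
have ld : (k.*2.+3 < n)%N by rewrite /n; lia.
pose b : 'I_n := Ordinal lb; pose c : 'I_n := Ordinal lc.
pose d : 'I_n := Ordinal ld.
(* Writing a for the vertex 2k, [s1] encodes the edges ac, bd and is odd; [s2] encodes ad, bc and is
   even. *)
pose s1 : 'S_n := tperm b c; pose s2 : 'S_n := (tperm b d * tperm b c)%g.
have [bc bd cd] : [/\ b != c, b != d & c != d].
  by rewrite -!val_eqE /=; split; lia.
have s1E (x : 'I_n) : s1 x = (if x == b then c else if x == c then b else x).
  by rewrite permE.
have s2E (x : 'I_n) : s2 x =
    (if x == b then d else if x == c then b else if x == d then c else x).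
  rewrite permM; have [->|xb] := eqVneq x b.
    by rewrite tpermL tpermD // eq_sym.
  have [->|xc] := eqVneq x c; first by rewrite [tperm b d c]tpermD ?tpermR // eq_sym.
  have [->|xd] := eqVneq x d; first by rewrite tpermR tpermL.
  by rewrite [tperm b d x]tpermD ?[tperm b c x]tpermD // eq_sym.
have s1V (x : 'I_n) : (s1 x = (if x == k.*2.+1 :> nat then k.*2.+2 else
    if x == k.*2.+2 :> nat then k.*2.+1 else x) :> nat)%N.
  by rewrite s1E -!val_eqE /=; do ![case: ifP].
have s2V (x : 'I_n) : (s2 x = (if x == k.*2.+1 :> nat then k.*2.+3 else
    if x == k.*2.+2 :> nat then k.*2.+1 else
    if x == k.*2.+3 :> nat then k.*2.+2 else x) :> nat)%N.
  by rewrite s2E -!val_eqE /=; do ![case: ifP].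
pose term (s : 'S_n) : R := (-1) ^+ s * \prod_(i < k.+2) F (s (ev i)) (s (od i)).
have pfE : pfaffian (\matrix_(i < n, j < n) F i j) = \sum_(s | pf_perm s) term s.
  apply: eq_bigr => s _; congr (_ * _).
  by apply: eq_bigr => i _; rewrite mxE.
have term0 s : pf_perm s -> s != 1%g -> s != s1 -> s != s2 -> term s = 0.
  move=> /andP[/forallP pf1 /forallP pf2] n0 n1 n2.
  (* Either an edge from a vertex below 2k skips its neighbour and kills the term, or
     [matching_tail] identifies s. *)
  have [/forallP nz | ] := boolP [forall i : 'I_k.+2,
      (s (ev i) < k.*2)%N ==> (s (od i) == (s (ev i)).+1 :> nat)]; last first.
    rewrite negb_forall => /existsP[i]; rewrite negb_imply => /andP[lt ne].
    by rewrite /term (bigD1 i) //= F0 // mul0r mulr0.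
  pose g x := if insub x is Some y then val (s (y : 'I_n)) else x.
  have gE (y : 'I_n) : g y = s y by rewrite /g valK.
  have gO x (lx : (x < n)%N) : g x = s (Ordinal lx) by rewrite -gE.
  have [|||||| fixg cases] := @matching_tail k g.
  - move=> x y lx ly; rewrite (gO x lx) (gO y ly).
    by move=> /val_inj/perm_inj/(congr1 val).
  - move=> y ly; exists (nat_of_ord ((s^-1)%g (Ordinal ly))) => //.
    by rewrite gE permKV.
  - by move=> x lx; rewrite (gO x lx).
  - move=> i li; have := pf1 (Ordinal li).
    by rewrite -!gE.
  - move=> i j ij lj; have := pf2 (Ordinal (ltn_trans ij lj)).
    by move=> /forallP/(_ (Ordinal lj))/implyP/(_ ij); rewrite -!gE.
  - move=> i li lt; have := nz (Ordinal li).
    by rewrite -!gE => /implyP/(_ lt)/eqP.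
  have gs (t : 'S_n) : (forall x : 'I_n, g x = t x) -> s = t.
    by move=> gt; apply/permP => x; apply: ord_inj; rewrite -gE gt.
  have gcase (x : 'I_n) : [\/ (x <= k.*2)%N, x = k.*2.+1 :> nat,
      x = k.*2.+2 :> nat | x = k.*2.+3 :> nat].
    have := ltn_ord x; rewrite {2}/n => lx.
    have [?|[?|[?|?]]] : (x <= k.*2)%N \/ x = k.*2.+1 :> nat \/
      x = k.*2.+2 :> nat \/ x = k.*2.+3 :> nat by lia.
    - by constructor 1.
    - by constructor 2.
    - by constructor 3.
    - by constructor 4.
  case: cases => -[gb gc gd].
  - case/eqP: n0; apply: gs => x; rewrite perm1.
    by case: (gcase x) => [/fixg|->|->|->].
  - case/eqP: n1; apply: gs => x; rewrite s1V.
    by case: (gcase x) => e; [rewrite fixg // | rewrite e gb | rewrite e gc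
      | rewrite e gd]; do ![case: eqP => ?]; lia.
  - case/eqP: n2; apply: gs => x; rewrite s2V.
    by case: (gcase x) => e; [rewrite fixg // | rewrite e gb | rewrite e gc
      | rewrite e gd]; do ![case: eqP => ?]; lia.
have pf0 : pf_perm (1%g : 'S_n).
  apply/andP; split; apply/forallP => i; rewrite ?perm1 //=.
  by apply/forallP => j; rewrite !perm1 /= ltn_double implybb.
have pf1 : pf_perm s1.
  apply/andP; split; apply/forallP => i.
    by rewrite !s1V /=; do ![case: eqP => ?]; lia.
  apply/forallP => j; apply/implyP => ij.
  by rewrite !s1V /=; do ![case: eqP => ?]; lia.
have pf2 : pf_perm s2.
  apply/andP; split; apply/forallP => i.
    by rewrite !s2V /=; do ![case: eqP => ?]; lia.
  apply/forallP => j; apply/implyP => ij.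
  by rewrite !s2V /=; do ![case: eqP => ?]; lia.
have s10 : s1 != 1%g.
  by apply/eqP => /permP/(_ b)/eqP; rewrite s1E eqxx perm1 eq_sym (negbTE bc).
have s20 : s2 != 1%g.
  by apply/eqP => /permP/(_ b)/eqP; rewrite s2E eqxx perm1 eq_sym (negbTE bd).
have s21 : s2 != s1.
  by apply/eqP => /permP/(_ b)/eqP; rewrite s2E s1E eqxx eq_sym (negbTE cd).
rewrite pfE (bigD1 1%g) //= (bigD1 s1) ?pf1 //= (bigD1 s2) ?pf2 ?s20 //=.
rewrite big1 ?addr0; last first.
  by move=> s /andP[/andP[/andP[? ?] ?] ?]; apply: term0.
rewrite /term odd_perm1 odd_tperm bc odd_permM !odd_tperm bc bd.
have prodE (t : 'S_n) (va vb vc vd : nat) :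
    (forall x : 'I_n, (x < k.*2)%N -> t x = x) ->
    (forall x : 'I_n, x = k.*2 :> nat -> t x = va :> nat) ->
    (forall x : 'I_n, x = k.*2.+1 :> nat -> t x = vb :> nat) ->
    (forall x : 'I_n, x = k.*2.+2 :> nat -> t x = vc :> nat) ->
    (forall x : 'I_n, x = k.*2.+3 :> nat -> t x = vd :> nat) ->
    \prod_(i < k.+2) F (t (ev i)) (t (od i)) =
    (\prod_(i < k) F i.*2 i.*2.+1) * (F va vb * F vc vd).
  move=> t0 ta tb tc td; rewrite !big_ord_recr /= -mulrA; congr (_ * (_ * _)).
  - by apply: eq_bigr => i _; rewrite !t0 //=; have := ltn_ord i; lia.
  - by rewrite ta ?tb.
  - by rewrite tc ?td.
rewrite (prodE 1%g k.*2 k.*2.+1 k.*2.+2 k.*2.+3); try by move=> x; rewrite perm1.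
rewrite (prodE s1 k.*2 k.*2.+2 k.*2.+1 k.*2.+3); first last;
  try by move=> x xE; rewrite s1V; do ![case: eqP => ?]; lia.
  by move=> x xE; apply: ord_inj; rewrite s1V; do ![case: eqP => ?]; lia.
rewrite (prodE s2 k.*2 k.*2.+3 k.*2.+1 k.*2.+2); first last;
  try by move=> x xE; rewrite s2V; do ![case: eqP => ?]; lia.
  by move=> x xE; apply: ord_inj; rewrite s2V; do ![case: eqP => ?]; lia.
by rewrite /= !expr0 expr1; ring.
Qed.

(** * Lifted equations for the three kinds of generic matrices *)

(** Joining the two presentations in one statement lets a single refutation exclude lifts to both
    R/p^2R and R. *)
Definition frobenius_lifts k (f : {mpoly int[k]}) (p : nat) : Prop :=
  exists (S : comPzRingType) (pi : {rmorphism {mpoly int[k]} -> S})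
    (L : {rmorphism S -> S}),
    (presents (in_ideal2 f (p ^ 2)%N%:R) pi \/ presents (in_ideal1 f) pi)
    /\ frobenius_lift p L.

Lemma not_frobenius_lifts k (f : {mpoly int[k]}) p :
  ~ frobenius_lifts f p -> no_frobenius_lift f p.
Proof.
by move=> nl; split=> S pi pres [L Lp]; apply: nl; exists S, pi, L;
  split=> //; [left | right].
Qed.

Lemma mulmnDl r (u v : 'X_{1..r}) k : ((u + v) *+ k = u *+ k + v *+ k)%MM.
Proof. by apply/mnmP => i; rewrite !(mnmDE, mulmnE) mulnDl. Qed.

Lemma sym_index_le n (i j : 'I_n) :
  ((if (i <= j)%N then (i, j) else (j, i)).1
   <= (if (i <= j)%N then (i, j) else (j, i)).2)%N.
Proof. by case: (leqP i j) => //= /ltnW. Qed.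

(** A total index, symmetric in i and j, that replaces the [insub] defaults of [symX]. *)
Definition sym_index n (i j : 'I_n) : symI n :=
  exist _ (if (i <= j)%N then (i, j) else (j, i)) (sym_index_le i j).

Lemma sym_indexC n (i j : 'I_n) : sym_index i j = sym_index j i.
Proof.
by apply: val_inj => /=; case: ltngtP => // /ord_inj ->.
Qed.

Lemma symXE n (i j : 'I_n) : symX n i j = var (sym_index i j).
Proof.
rewrite mxE; case: leqP => ij; last rewrite sym_indexC.
  rewrite insubT /=; congr var; apply: val_inj => /=; by rewrite ij.
rewrite insubT ?(ltnW ij) //= => le; congr var; apply: val_inj => /=.
by rewrite ltnW.
Qed.

Section Specialization.
Variables (p : nat) (B : comNzRingType).
Hypothesis p2 : (p ^ 2)%N%:R = 0 :> B.

Let pp : p%:R * p%:R = 0 :> B.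
Proof. by rewrite -natrM mulnn. Qed.

Let sq00 : 0 * 0 = 0 :> B := mul0r 0.

(** With independent row and column weights no variable has its weight supported inside that of
    another, so every variable is isolated. *)
Lemma lifts_genX n (M : 'M[B]_n) :
  frobenius_lifts (\det (genX n)) p -> \det M = 0 ->
  exists C : 'M[B]_n, \det (\matrix_(i, j) (M i j ^+ p + p%:R * C i j)) = 0
    /\ forall i j, exists z : int, C i j = z%:~R * M i j ^+ p.
Proof.
move=> [S [pi [L [pres Lp]]]] detM.
pose m (x : 'I_n * 'I_n) := M x.1 x.2.
pose s (i : 'I_n) : 'X_{1..n + n} := U_(lshift n i)%MM.
pose t (j : 'I_n) : 'X_{1..n + n} := U_(rshift n j)%MM.
pose w (x : 'I_n * 'I_n) := (s x.1 + t x.2)%MM.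
have [|F [c [F0 Fv iso]]] := @lift_specialization _ _ _ _ _ _ _ _ m w pres Lp p2.
  apply: (@leading0 _ _ (\sum_i s i + \sum_i t i)%MM).
  rewrite -det_map_mx -[X in leading _ _ _ X]detM; apply: leading_det => // i j.
  by rewrite !mxE; apply: leadingC; exact: subst_var.
exists (\matrix_(i, j) c (i, j)); split=> [|i j].
  apply: (@leading_eq0 _ _ p%:R (\sum_i s i *+ p + \sum_i t i *+ p)%MM).
  rewrite -F0 -det_map_mx; apply: leading_det => // i j.
  rewrite !mxE -mulmnDl; exact: (Fv (i, j)).
rewrite mxE; apply: (iso (i, j)); split=> [|[k l] _ supp].
  by rewrite mnmD_eq0 /s mnm1_eq0.
have := supp (lshift n k); rewrite !mnmDE !mnm1E /= eqxx !eq_shift addn0.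
have [<- _ | _ /(_ isT) //] := eqVneq i k.
have := supp (rshift n l); rewrite !mnmDE !mnm1E /= eqxx !eq_shift !add0n.
by have [<- _ | _ /(_ isT)] := eqVneq j l.
Qed.

(** Rows and columns share one torus here, because the entries (i, j) and (j, i) involve the same
    variable. *)
Definition pairwt n (i j : 'I_n) : 'X_{1..n} := (U_(i) + U_(j))%MM.

Lemma pairwt_supp n (i j k l : 'I_n) :
  (forall x, pairwt k l x != 0%N -> pairwt i j x != 0%N) ->
  ((k == i) || (k == j)) && ((l == i) || (l == j)).
Proof.
move=> supp; apply/andP; split; [have := supp k | have := supp l];
  rewrite !mnmDE !mnm1E eqxx ?addn1 (eq_sym i) (eq_sym j) => /(_ isT);
  by case: (_ == i); case: (_ == j).
Qed.

(** The weight of x_ij with i < j has support {i, j}, which determines the variable, so every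
    variable is isolated. *)
Lemma lifts_altX m (M : 'M[B]_(m.*2)) :
  frobenius_lifts (pfaffian (altX m.*2)) p -> pfaffian M = 0 ->
  exists z : 'I_m.*2 -> 'I_m.*2 -> int,
    pfaffian (\matrix_(i, j) (M i j ^+ p * (1 + p%:R * (z i j)%:~R))) = 0.
Proof.
move=> [S [pi [L [pres Lp]]]] pfM.
pose mm (x : altI m.*2) := M (val x).1 (val x).2.
pose w (x : altI m.*2) := pairwt (val x).1 (val x).2.
have map_pf (Q : comNzRingType) (F : {rmorphism ZX (altI m.*2) -> Q}) :
    F (pfaffian (altX m.*2)) = pfaffian (map_mx F (altX m.*2)).
  rewrite /pfaffian rmorph_sum; apply: eq_bigr => s _ /=.
  rewrite rmorphM rmorph_sign rmorph_prod; congr (_ * _).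
  by apply: eq_bigr => i _; rewrite [in RHS]mxE.
have altXE (i j : 'I_m.*2) (ij : (i < j)%N) :
    altX m.*2 i j = var (exist _ (i, j) ij : altI m.*2).
  rewrite mxE insubT /= [insub (j, i)]insubF ?subr0 //.
  by rewrite /= ltnNge ltnW.
have [|F [c [F0 Fv iso]]] := @lift_specialization _ _ _ _ _ _ _ _ mm w pres Lp p2.
  apply: (@leading0 _ _ (\sum_(i < m.*2) U_(i))%MM).
  rewrite map_pf -[X in leading _ _ _ X]pfM; apply: leading_pfaffian => // i j ij.
  by rewrite mxE (altXE _ _ ij); apply: leadingC; exact: subst_var.
have /fin_all_exists [z zP] (x : altI m.*2) :
    exists z : int, c x = z%:~R * mm x ^+ p.
  apply: iso; case: x => -[i j] /= ij; split=> [|[[k l] /= kl] _ supp].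
    by rewrite mnmD_eq0 mnm1_eq0.
  apply: val_inj => /=; move/pairwt_supp: supp => /=.
  case/andP=> /pred2P[] ek /pred2P[] el; subst k l => //; move: ij kl => /=; lia.
(* The default 0 for i >= j is harmless: the Pfaffian reads only entries above the diagonal. *)
exists (fun i j => oapp z 0 (insub (i, j))).
apply: (@leading_eq0 _ _ p%:R (\sum_(i < m.*2) U_(i) *+ p)%MM).
rewrite -F0 map_pf; apply: leading_pfaffian => // i j ij.
rewrite -mulmnDl mxE (altXE _ _ ij) [X in leading _ _ _ X]mxE insubT /=.
have := Fv (exist _ (i, j) ij); rewrite zP /mm /w /pairwt /=.
by congr leading; ring.
Qed.

(** Diagonal variables are always isolated. The support {i, j} of x_ij also contains those of x_ii
    and x_jj, so x_ij is isolated once M_ii and M_jj vanish. *)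
Lemma lifts_symX n (M : 'M[B]_n) :
  frobenius_lifts (\det (symX n)) p -> M^T = M -> \det M = 0 ->
  exists C : 'M[B]_n,
    [/\ C^T = C, \det (\matrix_(i, j) (M i j ^+ p + p%:R * C i j)) = 0,
        forall i, exists z : int, C i i = z%:~R * M i i ^+ p &
        forall i j, M i i = 0 -> M j j = 0 ->
          exists z : int, C i j = z%:~R * M i j ^+ p].
Proof.
move=> [S [pi [L [pres Lp]]]] Msym detM.
have MC i j : M i j = M j i by rewrite -[in RHS]Msym mxE.
pose m (x : symI n) := M (val x).1 (val x).2.
pose w (x : symI n) := pairwt (val x).1 (val x).2.
have mE i j : m (sym_index i j) = M i j.
  by rewrite /m /=; case: leqP => // _; rewrite MC.
have wE i j : w (sym_index i j) = pairwt i j.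
  by rewrite /w /=; case: leqP => // _; rewrite /pairwt addmC.
have [|F [c [F0 Fv iso]]] := @lift_specialization _ _ _ _ _ _ _ _ m w pres Lp p2.
  apply: (@leading0 _ _ (\sum_(i < n) U_(i) + \sum_(i < n) U_(i))%MM).
  rewrite -det_map_mx -[X in leading _ _ _ X]detM; apply: leading_det => // i j.
  rewrite mxE symXE; apply: leadingC; rewrite -mE -/(pairwt i j) -wE.
  exact: subst_var.
exists (\matrix_(i, j) c (sym_index i j)); split=> [||i|i j Mi Mj].
- by apply/matrixP => i j; rewrite !mxE sym_indexC.
- apply: (@leading_eq0 _ _ p%:R (\sum_(i < n) U_(i) *+ p + \sum_(i < n) U_(i) *+ p)%MM).
  rewrite -F0 -det_map_mx; apply: leading_det => // i j.
  rewrite -mulmnDl -/(pairwt i j) -wE mxE symXE !mxE -mE.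
  exact: Fv.
- rewrite mxE -mE; apply: iso; split=> [|x _]; first by rewrite wE mnmD_eq0 mnm1_eq0.
  rewrite wE => /pairwt_supp; rewrite !orbb => /andP[/eqP x1 /eqP x2].
  by case: x x1 x2 => -[a b] ab /= x1 x2; apply: val_inj; rewrite /= leqnn x1 x2.
- rewrite mxE -mE; apply: iso; split=> [|x mx]; first by rewrite wE mnmD_eq0 mnm1_eq0.
  rewrite wE; case: x mx => -[a b] ab mx /pairwt_supp /=.
  have -> : exist _ (a, b) ab = sym_index a b :> symI n.
    by apply: val_inj; rewrite /= ab.
  have {}mx : M a b != 0 by [].
  case/andP=> /pred2P[] ea /pred2P[] eb; move: mx; rewrite ea eb //.
  + by rewrite Mi eqxx.
  + by move=> _; apply: sym_indexC.
  + by rewrite Mj eqxx.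
Qed.
End Specialization.

(** * Reduction to a small core, and explicit small determinants *)

(** A unipotent factor clears e X because products of two e-blocks vanish, and 1 + e D is invertible
    with inverse 1 - e D. *)
Lemma det_block_square_zero (R : comNzRingType) (e : R) n1 n2 (A : 'M[R]_n1)
    (X : 'M[R]_(n1, n2)) (Y : 'M[R]_(n2, n1)) (D : 'M[R]_n2) :
  e * e = 0 ->
  \det (block_mx A (e *: X) (e *: Y) (1%:M + e *: D)) = 0 -> \det A = 0.
Proof.
move=> e2.
have -> : block_mx A (e *: X) (e *: Y) (1%:M + e *: D) =
    block_mx 1%:M (e *: X) 0 1%:M *m block_mx A 0 (e *: Y) (1%:M + e *: D).
  rewrite mulmx_block !mul1mx !mul0mx !add0r mulmxDr mulmx1.
  by rewrite -!scalemxAl -!scalemxAr !scalerA e2 !scale0r !addr0.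
rewrite det_mulmx det_ublock !det1 !mul1r det_lblock => AD.
have DD : (1%:M + e *: D) *m (1%:M - e *: D) = 1%:M.
  rewrite mulmxDl !mulmxBr !mul1mx mulmx1 -scalemxAl -scalemxAr scalerA e2.
  by rewrite scale0r subr0 subrK.
have := congr1 (fun M => \det A * \det M) DD.
by rewrite det_mulmx det1 mulr1 mulrA AD mul0r => <-.
Qed.

(* Off the core, C only contributes a unit factor, because p^2 = 0. *)
Lemma det_core (R : comNzRingType) (p : nat) n1 n2 (A : 'M[R]_n1)
    (C : 'M[R]_(n1 + n2)) (M := block_mx A 0 0 1%:M : 'M[R]_(n1 + n2)) :
  (0 < p)%N -> p%:R * p%:R = 0 :> R ->
  \det (\matrix_(i, j) (M i j ^+ p + p%:R * C i j)) = 0 ->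
  \det (\matrix_(i, j) (A i j ^+ p + p%:R * C (lshift n2 i) (lshift n2 j))) = 0.
Proof.
move=> p0 p2 det0.
apply: (@det_block_square_zero _ p%:R n1 n2 _ (ursubmx C) (dlsubmx C) (drsubmx C)) => //.
rewrite -{}[RHS]det0; congr (\det _); rewrite -[RHS]submxK.
have z0 : 0 ^+ p = 0 :> R by rewrite expr0n eqn0Ngt p0.
have Mul i j : M (lshift n2 i) (lshift n2 j) = A i j by apply: block_mxEul.
have Mur i j : M (lshift n2 i) (rshift n1 j) = 0 by rewrite /M block_mxEur mxE.
have Mdl i j : M (rshift n1 i) (lshift n2 j) = 0 by rewrite /M block_mxEdl mxE.
have Mdr i j : M (rshift n1 i) (rshift n1 j) = (i == j)%:R.
  by rewrite /M block_mxEdr mxE.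
clearbody M.
congr block_mx; apply/matrixP => i j; rewrite !mxE.
- by rewrite Mul.
- by rewrite Mur z0 add0r.
- by rewrite Mdl z0 add0r.
- by rewrite Mdr; case: (_ == _); rewrite ?expr1n ?z0.
Qed.

Lemma det3E (R : comNzRingType) (F : nat -> nat -> R) :
  \det (\matrix_(i < 3, j < 3) F i j) =
    F 0 0 * F 1 1 * F 2 2 + F 0 1 * F 1 2 * F 2 0 + F 0 2 * F 1 0 * F 2 1
  - F 0 2 * F 1 1 * F 2 0 - F 0 1 * F 1 0 * F 2 2 - F 0 0 * F 1 2 * F 2 1.
Proof.
do 3 rewrite !(expand_det_row _ ord0) !big_ord_recl !big_ord0 /cofactor.
rewrite !det_mx00 !mxE /=.
by rewrite /bump /=; ring.
Qed.

(** With a, b, c the products over the three perfect matchings, this is a^2 + b^2 + c^2 - 2ab - 2ac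
    - 2bc, which vanishes when a, b, c are squares of x, y, x + y. *)
Lemma det4_symE (R : comNzRingType) (F : nat -> nat -> R) :
  (forall i j, F i j = F j i) -> (forall i, F i i = 0) ->
  \det (\matrix_(i < 4, j < 4) F i j) =
   (F 0 1 * F 2 3 + F 0 2 * F 1 3 - F 0 3 * F 1 2) ^+ 2
    - 4%:R * (F 0 1 * F 2 3) * (F 0 2 * F 1 3).
Proof.
move=> FC F0.
rewrite (expand_det_row _ ord0) !big_ord_recl !big_ord0 /cofactor.
have E (k : 'I_4) : row' ord0 (col' k (\matrix_(i < 4, j < 4) F i j)) =
   \matrix_(i < 3, j < 3) F i.+1 (bump k j).
  by apply/matrixP => i j; rewrite !mxE.
have D (k : 'I_4) := det3E (fun i j => F i.+1 (bump k j)).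
rewrite !E !D !mxE /= /bump /=.
rewrite (FC 1 0) (FC 2 0) (FC 2 1) (FC 3 0) (FC 3 1) (FC 3 2) !F0.
by ring.
Qed.

(** * Impossible polynomial relations modulo p^2 *)

Lemma coef1_X1n (R : comNzRingType) n : (('X + 1 : {poly R}) ^+ n)`_1 = n%:R.
Proof.
have c0 k : (('X + 1 : {poly R}) ^+ k)`_0 = 1.
  by rewrite -horner_coef0 !hornerE expr1n.
elim: n => [|n IH]; first by rewrite expr0 coefC.
by rewrite exprS mulrDl mul1r coefD coefXM /= c0 IH -natr1 addrC.
Qed.

Section Arithmetic.
Variable p : nat.
Hypothesis p_pr : prime p.

Local Notation Zp2 := 'Z_(p ^ 2).
Local Notation B := {poly 'Z_(p ^ 2)}.

Let p2_gt1 : (1 < p ^ 2)%N.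
Proof. by have := prime_gt1 p_pr; nia. Qed.

Let p_gt1 := prime_gt1 p_pr.

Lemma Zp2_nat_eq0 n : (n%:R == 0 :> Zp2) = (p ^ 2 %| n)%N.
Proof. by rewrite Zp_nat -val_eqE /= Zp_cast. Qed.

Lemma p2_eq0 : (p ^ 2)%N%:R = 0 :> B.
Proof. by rewrite -polyC_natr; apply/eqP; rewrite polyC_eq0 Zp2_nat_eq0. Qed.

Lemma pp_eq0 : p%:R * p%:R = 0 :> B.
Proof. by rewrite -natrM mulnn p2_eq0. Qed.

(* [h] is ((s + 1)^p - s^p - 1) / p. *)
Lemma freshman_defect :
  exists2 h : B, ('X + 1) ^+ p = 'X^p + 1 + p%:R * h & h`_1 = 1.
Proof.
exists (\poly_(k < p) (if k == 0%N then 0 else ('C(p, k) %/ p)%N%:R)); last first.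
  by rewrite coef_poly p_gt1 /= bin1 divnn prime_gt0.
apply/polyP => k.
have -> : ('X + 1 : B) ^+ p = \poly_(i < p.+1) 'C(p, i)%:R.
  by rewrite exprD1n poly_def; apply: eq_bigr => i _; rewrite scaler_nat.
rewrite !coefD -polyC_natr coefCM coefXn coefC !coef_poly ltnS.
have [lt_kp | lt_pk | ->] := ltngtP k p.
- have [-> | k0] := eqVneq k 0%N; first by rewrite bin0 mulr0 add0r addr0.
  rewrite !add0r -natrM mulnC divnK // prime_dvd_bin // lt0n k0 //.
- by rewrite (gtn_eqF (leq_ltn_trans (leq0n p) lt_pk)) mulr0 !addr0.
- by rewrite binn (gtn_eqF (prime_gt0 p_pr)) mulr0 !addr0.
Qed.

(** The coefficient of s is -w p = -p, nonzero modulo p^2; neither s^p nor the constant contributes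
    to it. *)
Lemma no_additive_relation (u v w : int) :
  p%:R * w%:~R = p%:R :> Zp2 ->
  u%:~R * 'X^p + v%:~R - w%:~R * ('X + 1) ^+ p = 0 :> B -> False.
Proof.
move=> pw /(congr1 (fun q : B => q`_1)).
rewrite -!(rmorph_int (@polyC Zp2)) coefB coefD !coefCM coefXn coefC coef1_X1n coef0.
rewrite [(1 == p)%N](ltn_eqF p_gt1) mulr0 !add0r mulrC pw => /eqP.
rewrite oppr_eq0 Zp2_nat_eq0 => /dvdn_leq; nia.
Qed.

(** Modulo p^2 the left side is -4p(b - c - 2h)s^p - 4p Q s^(2p). Since h has linear coefficient 1,
    its coefficient at s^(p+1) is 8p, which is nonzero for odd p. *)
Lemma no_quadratic_relation (a b c : int) : p != 2 ->
  ('X^p ^+ 2 * (1 + p%:R * a%:~R) + (1 + p%:R * b%:~R)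
     - (('X + 1) ^+ p) ^+ 2 * (1 + p%:R * c%:~R)) ^+ 2
   - 4%:R * ('X^p ^+ 2 * (1 + p%:R * a%:~R)) * (1 + p%:R * b%:~R) = 0 :> B ->
  False.
Proof.
move=> p_neq2; have [h -> h1] := freshman_defect.
set e : B := 'X^p; set P : B := p%:R; set a' := a%:~R; set b' := b%:~R.
set c' := c%:~R.
pose Q := a' * e - 2%:R * h - c' * (2%:R + e) + a' + b'.
have -> : (e ^+ 2 * (1 + P * a') + (1 + P * b')
     - (e + 1 + P * h) ^+ 2 * (1 + P * c')) ^+ 2
   - 4%:R * (e ^+ 2 * (1 + P * a')) * (1 + P * b') =
   - (4%:R * P * (b' - c' - 2%:R * h)) * e - 4%:R * P * (Q * e) * e.
  have PP : P * P = 0 := pp_eq0.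
  (* The inner difference is p K - 2e. Its square contributes 4e^2 - 4p K e, and the 4e^2 cancels
     against the subtracted product. *)
  pose K := a' * e ^+ 2 + b' - 2%:R * (e + 1) * h - c' * (e + 1) ^+ 2.
  have -> : e ^+ 2 * (1 + P * a') + (1 + P * b')
      - (e + 1 + P * h) ^+ 2 * (1 + P * c') = P * K - 2%:R * e.
    transitivity (P * K - 2%:R * e
      - (P * P) * (h ^+ 2 + 2%:R * (e + 1) * h * c' + P * h ^+ 2 * c')).
      by rewrite /K; ring.
    by rewrite PP mul0r subr0.
  transitivity (- (4%:R * P * (b' - c' - 2%:R * h)) * e
    - 4%:R * P * (Q * e) * e + (P * P) * (K ^+ 2 - 4%:R * e ^+ 2 * a' * b')).
    by rewrite /K /Q; ring.
  by rewrite PP mul0r addr0.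
move=> /(congr1 (fun q : B => q`_p.+1)).
rewrite coefB !coefMXn ltnNge leqnSn /= subSnn coef0.
rewrite /P /a' /b' /c' -!(rmorph_int (@polyC Zp2)) -!polyC_natr -!polyCM.
rewrite coefN !coefCM coefMXn p_gt1 mulr0 subr0 !coefB coefCM h1 !coefC /=.
rewrite subrr sub0r mulr1 mulrN opprK -!natrM => /eqP; rewrite Zp2_nat_eq0.
rewrite mulnAC -mulnn dvdn_pmul2r ?prime_gt0 // (Euclid_dvdX 2 3 p_pr).
by rewrite /= andbT dvdn_prime2 // (negbTE p_neq2).
Qed.
End Arithmetic.

(** * Singular matrices that exclude a lift *)

Section Obstruction.
Variable p : nat.
Hypothesis p_pr : prime p.
Local Notation Zp2 := 'Z_(p ^ 2).
Local Notation B := {poly 'Z_(p ^ 2)}.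

Let p_gt0 := prime_gt0 p_pr.
Let z0 : 0 ^+ p = 0 :> B.
Proof. by rewrite expr0n eqn0Ngt p_gt0. Qed.

(** The equation p a = p in Z/p^2 says that a is 1 modulo p, the condition on w in
    [no_additive_relation]. *)
Lemma Zp2_unit_mod (z : int) : p%:R * (1 + p%:Z * z)%:~R = p%:R :> Zp2.
Proof.
have pp : p%:R * p%:R = 0 :> Zp2.
  by rewrite -natrM mulnn; apply/eqP; rewrite Zp2_nat_eq0.
by rewrite intrD intrM mulrDr mulr1 mulrA -pmulrn pp mul0r addr0.
Qed.

Lemma Zp2_unit_modM (a b : int) : p%:R * a%:~R = p%:R :> Zp2 ->
  p%:R * b%:~R = p%:R :> Zp2 -> p%:R * (a * b)%:~R = p%:R :> Zp2.
Proof. by rewrite intrM mulrA => -> ->. Qed.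

Lemma genX_no_lift n : (3 <= n)%N -> ~ frobenius_lifts (\det (genX n)) p.
Proof.
move=> /subnKC <-; set k := (n - 3)%N => lifts.
(* The two diagonal zeros leave three terms in the determinant, s + 1 - (s + 1). An identity block
   pads the matrix to size n. *)
pose FA (i j : nat) : B :=
  nth 0 (nth [::] [:: [:: 0; 1; 1]; [:: 1; 0; 'X]; [:: 1; 1; 'X + 1]] i) j.
pose A : 'M[B]_3 := \matrix_(i < 3, j < 3) FA i j.
have detA : \det A = 0 by rewrite /A (det3E FA) /FA /=; ring.
have detM : \det (block_mx A 0 0 (1%:M : 'M_k)) = 0.
  by rewrite det_ublock detA mul0r.
have [C [detC Cz]] := lifts_genX (p2_eq0 p_pr) lifts detM.
have /fin_all_exists [z zP] (x : 'I_3 * 'I_3) :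
    exists z : int, C (lshift k x.1) (lshift k x.2) = z%:~R * FA x.1 x.2 ^+ p.
  have [z] := Cz (lshift k x.1) (lshift k x.2).
  by rewrite block_mxEul mxE; exists z.
have := det_core p_gt0 (pp_eq0 p_pr) detC.
(* Isolation makes each corrected entry a p-th power times a factor 1 + p z, which is [y]. *)
pose y i j : int := 1 + p%:Z * z (inord i, inord j).
have -> : \matrix_(i, j) (A i j ^+ p + p%:R * C (lshift k i) (lshift k j)) =
    \matrix_(i < 3, j < 3) ((y i j)%:~R * FA i j ^+ p).
  apply/matrixP => i j; rewrite !mxE (zP (i, j)) /y !inord_val /=.
  by rewrite intrD intrM -pmulrn; ring.
rewrite (det3E (fun i j => (y i j)%:~R * FA i j ^+ p)) /FA /= z0 !expr1n => E.
apply: (@no_additive_relation p p_pr (y 0 1 * y 1 2 * y 2 0)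
  (y 0 2 * y 1 0 * y 2 1) (y 0 1 * y 1 0 * y 2 2)).
  by do ![apply: Zp2_unit_modM | apply: Zp2_unit_mod].
by rewrite -[RHS]E !intrM; ring.
Qed.

Lemma altX_no_lift m : (2 <= m)%N ->
  ~ frobenius_lifts (pfaffian (altX m.*2)) p.
Proof.
case: m => [|[|k]] // _ lifts.
(* The core has Pfaffian s - (s + 1) + 1 = 0. *)
pose core (i j : nat) : B := nth 0 (nth [::]
  [:: [:: 0; 'X; 'X + 1; 1]; [:: 0; 0; 1; 1]; [:: 0; 0; 0; 1]] i) j.
(* Each row i < 2k has its only nonzero entry, 1, in column i + 1, as [pfaffian_tail] requires. *)
pose F (i j : nat) : B := if (i < k.*2)%N then (j == i.+1)%:R
  else core (i - k.*2)%N (j - k.*2)%N.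
have Fout i j : (i < k.*2)%N -> (i < j)%N -> j != i.+1 -> F i j = 0.
  by move=> ik _ ij; rewrite /F ik (negbTE ij).
have Fcore i j a b : i = (a + k.*2)%N -> j = (b + k.*2)%N -> F i j = core a b.
  by move=> -> ->; rewrite /F ltnNge leq_addl /= !addnK.
have F1 (i : 'I_k) : F i.*2 i.*2.+1 = 1.
  by rewrite /F ltn_double ltn_ord eqxx.
have F01 : F k.*2 k.*2.+1 = 'X by rewrite (Fcore _ _ 0 1).
have F02 : F k.*2 k.*2.+2 = 'X + 1 by rewrite (Fcore _ _ 0 2).
have F03 : F k.*2 k.*2.+3 = 1 by rewrite (Fcore _ _ 0 3).
have F12 : F k.*2.+1 k.*2.+2 = 1 by rewrite (Fcore _ _ 1 2).
have F13 : F k.*2.+1 k.*2.+3 = 1 by rewrite (Fcore _ _ 1 3).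
have F23 : F k.*2.+2 k.*2.+3 = 1 by rewrite (Fcore _ _ 2 3).
pose M : 'M[B]_(k.+2.*2) := \matrix_(i, j) F i j.
have pfM : pfaffian M = 0.
  rewrite /M (pfaffian_tail Fout) F01 F02 F03 F12 F13 F23.
  by rewrite [X in _ * X](_ : _ = 0) ?mulr0 //; ring.
have [z] := lifts_altX (p2_eq0 p_pr) lifts pfM.
pose y (i j : nat) : int :=
  1 + p%:Z * oapp (fun i' => oapp (z i') 0 (insub j)) 0 (insub i).
pose G i j := (y i j)%:~R * F i j ^+ p.
have -> : \matrix_(i, j) (M i j ^+ p * (1 + p%:R * (z i j)%:~R)) =
    \matrix_(i < k.+2.*2, j < k.+2.*2) G i j.
  apply/matrixP => i j; rewrite !mxE /G /y !valK /= intrD intrM -pmulrn.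
  by ring.
rewrite pfaffian_tail => [|i j ik ij ne]; last by rewrite /G Fout // z0 mulr0.
rewrite (eq_bigr (fun i : 'I_k => (y i.*2 i.*2.+1)%:~R)) => [|i _]; last first.
  by rewrite /G F1 expr1n mulr1.
rewrite -rmorph_prod /G F01 F02 F03 F12 F13 F23 !expr1n => E.
(* [u] collects the factors of the first k edges; it is again 1 modulo p. *)
set u := \prod_(i < k) _ in E.
apply: (@no_additive_relation p p_pr
  (u * (y k.*2 k.*2.+1 * y k.*2.+2 k.*2.+3))
  (u * (y k.*2 k.*2.+3 * y k.*2.+1 k.*2.+2))
  (u * (y k.*2 k.*2.+2 * y k.*2.+1 k.*2.+3))).
  apply: Zp2_unit_modM; last by apply: Zp2_unit_modM; apply: Zp2_unit_mod.
  apply: (big_ind (fun a : int => p%:R * a%:~R = p%:R :> Zp2)).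
  - by rewrite mulr1.
  - exact: Zp2_unit_modM.
  - by move=> i _; apply: Zp2_unit_mod.
by rewrite -[RHS]E !intrM; ring.
Qed.

Lemma symX_no_lift4 n : p != 2 -> (4 <= n)%N ->
  ~ frobenius_lifts (\det (symX n)) p.
Proof.
move=> p_neq2 /subnKC <-; set k := (n - 4)%N => lifts.
(* The matching products are s^2, 1 and (s + 1)^2, so the determinant vanishes; the zero diagonal
   makes all off-diagonal variables isolated. *)
pose FA (i j : nat) : B := nth 0 (nth [::]
  [:: [:: 0; 'X; 1; 'X + 1]; [:: 'X; 0; 'X + 1; 1];
      [:: 1; 'X + 1; 0; 'X]; [:: 'X + 1; 1; 'X; 0]] i) j.
have FAC i j : FA i j = FA j i.
  by case: i j => [|[|[|[|i]]]] [|[|[|[|j]]]] //=; rewrite /FA /= ?nth_nil.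
have FA0 i : FA i i = 0.
  by case: i => [|[|[|[|i]]]] //=; rewrite /FA /= ?nth_nil.
pose A : 'M[B]_4 := \matrix_(i < 4, j < 4) FA i j.
have detA : \det A = 0 by rewrite /A (det4_symE FAC FA0) /FA /=; ring.
have detM : \det (block_mx A 0 0 (1%:M : 'M_k)) = 0.
  by rewrite det_ublock detA mul0r.
have symM : (block_mx A 0 0 (1%:M : 'M_k))^T = block_mx A 0 0 1%:M.
  rewrite tr_block_mx !trmx0 trmx1; congr block_mx.
  by apply/matrixP => i j; rewrite !mxE FAC.
have [C [Csym detC _ Cz]] := lifts_symX (p2_eq0 p_pr) lifts symM detM.
have /fin_all_exists [z zP] (x : 'I_4 * 'I_4) :
    exists z : int, C (lshift k x.1) (lshift k x.2) = z%:~R * FA x.1 x.2 ^+ p.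
  have [||z] := Cz (lshift k x.1) (lshift k x.2); rewrite block_mxEul mxE //.
  by exists z.
have := det_core p_gt0 (pp_eq0 p_pr) detC.
pose F i j : B := FA i j ^+ p + p%:R * C (lshift k (inord i)) (lshift k (inord j)).
have -> : \matrix_(i, j) (A i j ^+ p + p%:R * C (lshift k i) (lshift k j)) =
    \matrix_(i < 4, j < 4) F i j.
  by apply/matrixP => i j; rewrite !mxE /F !inord_val.
have FE i j : (i < 4)%N -> (j < 4)%N ->
    F i j = FA i j ^+ p * (1 + p%:R * (z (inord i, inord j))%:~R).
  by move=> li lj; rewrite /F (zP (inord i, inord j)) /= !inordK //; ring.
have FC i j : F i j = F j i.
  by rewrite /F FAC -[in LHS]Csym mxE.
have F0 i : F i i = 0.
  by rewrite /F (zP (inord i, inord i)) /= !FA0 z0 mulr0 mulr0 addr0.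
rewrite (det4_symE FC F0) !FE // /FA /= !expr1n => E.
pose y i j := z (inord i, inord j).
(* Each argument comes from (1 + p x)(1 + p y) = 1 + p(x + y + p x y). *)
apply: (@no_quadratic_relation p p_pr (y 0 1 + y 2 3 + p%:Z * (y 0 1 * y 2 3))
  (y 0 2 + y 1 3 + p%:Z * (y 0 2 * y 1 3))
  (y 0 3 + y 1 2 + p%:Z * (y 0 3 * y 1 2)) p_neq2).
rewrite -[RHS]E !(intrD, intrM) -!pmulrn /y.
by ring.
Qed.
End Obstruction.

Lemma symX_no_lift2 n : (3 <= n)%N -> ~ frobenius_lifts (\det (symX n)) 2.
Proof.
move=> /subnKC <-; set k := (n - 3)%N => lifts.
pose B : comNzRingType := 'Z_(2 ^ 2).
have p2 : (2 ^ 2)%N%:R = 0 :> B by apply/eqP; rewrite Zp2_nat_eq0.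
have pp : 2%:R * 2%:R = 0 :> B by rewrite -natrM.
(* The determinant is 1 + 1 - 2 = 0, already over the integers. *)
pose FA (i j : nat) : B :=
  nth 0 (nth [::] [:: [:: 0; 1; 1]; [:: 1; 0; 1]; [:: 1; 1; 2%:R]] i) j.
have FAC i j : FA i j = FA j i.
  by case: i j => [|[|[|i]]] [|[|[|j]]] //=; rewrite /FA /= ?nth_nil.
pose A : 'M[B]_3 := \matrix_(i < 3, j < 3) FA i j.
have detA : \det A = 0 by rewrite /A (det3E FA) /FA /=; ring.
have detM : \det (block_mx A 0 0 (1%:M : 'M_k)) = 0.
  by rewrite det_ublock detA mul0r.
have symM : (block_mx A 0 0 (1%:M : 'M_k))^T = block_mx A 0 0 1%:M.
  rewrite tr_block_mx !trmx0 trmx1; congr block_mx.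
  by apply/matrixP => i j; rewrite !mxE FAC.
have [C [Csym detC Cz _]] := lifts_symX p2 lifts symM detM.
have := det_core (isT : 0 < 2)%N pp detC.
pose c i j : B := C (lshift k (inord i)) (lshift k (inord j)).
pose F i j : B := FA i j ^+ 2 + 2%:R * c i j.
have -> : \matrix_(i, j) (A i j ^+ 2 + 2%:R * C (lshift k i) (lshift k j)) =
    \matrix_(i < 3, j < 3) F i j.
  by apply/matrixP => i j; rewrite !mxE /F /c !inord_val.
have cC i j : c i j = c j i by rewrite /c -[in LHS]Csym mxE.
(* The diagonal entries 0 and 2 have square 0 modulo 4, and their corrections are multiples of these
   squares. *)
have F0 i : (i < 3)%N -> F i i = 0.
  move=> li; have [z] := Cz (lshift k (inord i)).
  rewrite block_mxEul mxE inordK // -/(c i i) /F => ->.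
  have -> : FA i i ^+ 2 = 0; last by rewrite mulr0 mulr0 addr0.
  by case: i li => [|[|[|]]] // _; rewrite /FA /= expr2 ?mul0r.
rewrite (det3E F) !F0 // !(mul0r, mulr0, add0r, subr0, addr0).
rewrite /F /FA /= !expr1n (cC 1%N 0%N) (cC 2 0%N) (cC 2 1%N) => E.
(* With zero diagonal the determinant is twice the product of the three off-diagonal entries. Each
   is 1 + 2c, so the value is 2 modulo 4 whatever the corrections c. *)
have : 2%:R = 0 :> B.
  rewrite -[RHS]E.
  transitivity (2%:R + 2%:R * 2%:R * (c 0 1 + c 1 2 + c 0 2
    + 2%:R * (c 0 1 * c 1 2 + c 0 1 * c 0 2 + c 1 2 * c 0 2)
    + 4%:R * (c 0 1 * c 1 2 * c 0 2))); last by ring.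
  by rewrite pp mul0r addr0.
by move/eqP; rewrite Zp2_nat_eq0.
Qed.

Theorem theorem1p4 (p : nat) : prime p ->
  (forall n : nat, (3 <= n)%N -> no_frobenius_lift (\det (genX n)) p) /\
  (forall m : nat, (2 <= m)%N -> no_frobenius_lift (pfaffian (altX (m.*2)) ) p) /\
  (forall n : nat, (3 <= n)%N -> (p == 2)%N || (4 <= n)%N ->
       no_frobenius_lift (\det (symX n)) p).
Proof.
move=> p_pr; split; [|split] => n n_ge => [||pn]; apply: not_frobenius_lifts.
- exact: genX_no_lift.
- exact: altX_no_lift.
- have [p2 | p_neq2] := eqVneq p 2; first by rewrite p2; apply: symX_no_lift2.
  by apply: symX_no_lift4 => //; move: pn; rewrite (negbTE p_neq2).
Qed.
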